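(* Let $n\ge 2$ be an integer, and let $M(n)=\max\{\eta(G): |G|=n\}$ and $m(n)=\min\{\eta(G): |G|=n\}$, where $G$ ranges over all groups of order $n$. Then: (a) $M(n)=\tau(n)$, and among groups of order $n$ this maximum is attained (up to isomorphism) only by $\mathbb{Z}_n$. (b) $m(n)\ge\pi(n)+1$. (c) If $n=p^{k}$ is a power of a prime $p$, then $m(n)=2$. (d) $m(n)=\pi(n)+1$ if and only if there is a group of order $n$ all of whose nontrivial elements have prime order. (e) If $\gcd(n,\varphi(n))=1$, then $\mathbb{Z}_n$ is (up to isomorphism) the only group of order $n$, so $m(n)=M(n)=\tau(n)$.
   Context: For a finite group $G$, $\omega(G)$ denotes the set of orders of elements of $G$ and $\eta(G)=|\omega(G)|$. $\tau(n)$ is the number of positive divisors of $n$, $\pi(n)$ is the number of distinct primes dividing $n$, $\varphi$ is Euler's totient function, and $\mathbb{Z}_n$ is the cyclic group of order $n$. *)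

(* Defs.v *)
From mathcomp Require Import all_boot all_order all_algebra all_fingroup all_solvable.
From mathcomp Require Import finmap.
From mathcomp Require Import boolp classical_sets.

Set Implicit Arguments.
Unset Strict Implicit.
Unset Printing Implicit Defensive.

Definition omega (gT : finGroupType) (G : {group gT}) : {fset nat} :=
  [fset #[x]%g | x in G]%fset.

Definition eta (gT : finGroupType) (G : {group gT}) : nat := #|` omega G |.

Definition tau (n : nat) : nat := size (divisors n).

Definition num_primes (n : nat) : nat := size (primes n).

Definition eta_value (n e : nat) : Prop :=
  exists (gT : finGroupType) (G : {group gT}), #|G| = n /\ eta G = e.

Definition is_max (P : nat -> Prop) (e : nat) : Prop :=
  P e /\ forall f : nat, P f -> f <= e.

Definition is_min (P : nat -> Prop) (e : nat) : Prop :=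
  P e /\ forall f : nat, P f -> e <= f.

(* The default value 0 is only taken when n = 0, as there are no groups of
   order 0: see max_etaP and min_etaP. *)
Definition max_eta (n : nat) : nat :=
  xget 0 [set e | is_max (eta_value n) e]%classic.

Definition min_eta (n : nat) : nat :=
  xget 0 [set e | is_min (eta_value n) e]%classic.

Lemma eta_le_card (gT : finGroupType) (G : {group gT}) : eta G <= #|G|.
Proof. by rewrite /eta /omega (leq_trans (leq_imfset_card _ _ _)) // cardE. Qed.

Lemma eta_value_Zp (n : nat) : 0 < n -> eta_value n (eta (Zp_group n)).
Proof. by move=> n_gt0; exists _, (Zp_group n); rewrite card_Zp. Qed.

Lemma max_etaP (n : nat) : 0 < n -> is_max (eta_value n) (max_eta n).
Proof.
move=> n_gt0.
have exP : exists e, `[< eta_value n e >].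
  by exists (eta (Zp_group n)); apply/asboolP/eta_value_Zp.
have leP e : `[< eta_value n e >] -> e <= n.
  by move=> /asboolP[gT [G [<- <-]]]; apply: eta_le_card.
have [e /asboolP Pe max_e] := ex_maxnP exP leP.
apply: (@xgetPex _ 0 [set e | is_max (eta_value n) e]%classic).
by exists e; split=> // f Pf; apply/max_e/asboolP.
Qed.

Lemma min_etaP (n : nat) : 0 < n -> is_min (eta_value n) (min_eta n).
Proof.
move=> n_gt0.
have exP : exists e, `[< eta_value n e >].
  by exists (eta (Zp_group n)); apply/asboolP/eta_value_Zp.
have [e /asboolP Pe min_e] := ex_minnP exP.
apply: (@xgetPex _ 0 [set e | is_min (eta_value n) e]%classic).
by exists e; split=> // f Pf; apply/min_e/asboolP.
Qed.

(* Main.v *)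
Require Import Defs.
From mathcomp Require Import all_boot all_order all_algebra all_fingroup all_solvable.
From mathcomp Require Import finmap.

(** Everything about eta follows from locating omega(G) between two lists of
    integers determined by n = |G|.

    By Lagrange's theorem omega(G) is contained in the divisors of n, so
    eta(G) <= tau(n).  Equality forces n itself to be the order of an element,
    so that G is cyclic; conversely a cyclic group has elements of every order
    dividing n ([cyclic_eta]).

    By Cauchy's theorem omega(G) contains 1 and the primes dividing n, so
    eta(G) >= pi(n) + 1.  Equality means that omega(G) is exactly this list,
    that is, that nontrivial elements have prime order ([eta_eq_num_primes]).
    For n = p ^ k this happens in the elementary abelian group of order n.

    There remains the theorem that gcd(n, phi(n)) = 1 makes every group G of
    order n cyclic ([coprime_totient_cyclic]).  The condition passes to
    divisors of n, so in an induction on n the proper subgroups and the proper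
    quotients of G are cyclic.  If the centre is nontrivial, then G / Z(G) is
    cyclic, so G is abelian, hence cyclic because n is squarefree.  If the
    centre is trivial, the centraliser of a nontrivial element is a proper,
    hence cyclic, subgroup, and:
    - a nontrivial b in C(a) has C(b) = C(a), since C(a) and C(b) are abelian;
      distinct centralisers thus meet trivially;
    - the centraliser C = C(a) is its own normaliser, because N(C) acts on C
      through a group of order dividing both n and |Aut C| = phi(|C|), which
      are coprime; so N(C) centralises a, an element of C.
    So the conjugates of C cover (|C| - 1) |G : C| = n - |G : C| >= n / 2
    nontrivial elements.  This is fewer than n - 1, and any nontrivial element
    left over yields a second such family, disjoint from the first.  Together
    they would fill at least n of the n - 1 nontrivial elements of G:
    a centreless G is trivial ([centreless_trivial]). *)

Set Implicit Arguments.
Unset Strict Implicit.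
Unset Printing Implicit Defensive.

Local Open Scope group_scope.

(** * Bounds on the set of element orders *)

Section ElementOrders.

Variables (gT : finGroupType) (G : {group gT}).

Lemma omegaP d : reflect (exists2 x, x \in G & d = #[x]) (d \in omega G).
Proof. exact: imfsetP. Qed.

Lemma omega_sub_divisors : {subset omega G <= divisors #|G|}.
Proof. by move=> _ /omegaP[x Gx ->]; rewrite -dvdn_divisors ?order_dvdG. Qed.

Lemma eta_le_tau : eta G <= tau #|G|.
Proof. exact: uniq_leq_size (fset_uniq _) omega_sub_divisors. Qed.

Lemma divisors_sub_omega : cyclic G -> {subset divisors #|G| <= omega G}.
Proof.
case/cyclicP=> x defG d; rewrite -dvdn_divisors // => d_n.
apply/omegaP; exists (x ^+ (#[x] %/ d)); first by rewrite defG mem_cycle.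
rewrite defG -/#[x] in d_n; have d_gt0 := dvdn_gt0 (order_gt0 x) d_n.
by rewrite orderXdiv ?dvdn_div // divnA // mulKn.
Qed.

(** When every divisor of |G| is an element order, |G| is one, and an element
    of order |G| generates G. *)
Lemma cyclic_eta : cyclic G = (eta G == tau #|G|).
Proof.
apply/idP/eqP=> [cycG | eta_tau].
  apply/eqP; rewrite eqn_leq eta_le_tau /=.
  exact: uniq_leq_size (divisors_uniq _) (divisors_sub_omega cycG).
have [|_ eq_om] := uniq_min_size (fset_uniq _) omega_sub_divisors.
  by rewrite -[size (divisors _)]/(tau _) -eta_tau.
have /omegaP[x Gx oG]: #|G| \in omega G.
  by apply: etrans (eq_om _) _; rewrite -dvdn_divisors ?dvdnn.
apply/cyclicP; exists x.
by apply/esym/eqP; rewrite eqEcard cycle_subG Gx oG /=.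
Qed.

Lemma primes_sub_omega : {subset 1%N :: primes #|G| <= omega G}.
Proof.
move=> d; rewrite inE => /predU1P[-> | ].
  by apply/omegaP; exists 1; rewrite ?order1.
rewrite mem_primes => /and3P[d_pr _ /(Cauchy d_pr)[x Gx ox]].
by apply/omegaP; exists x.
Qed.

Lemma uniq_one_primes n : uniq (1%N :: primes n).
Proof. by rewrite /= primes_uniq mem_primes. Qed.

Lemma eta_ge_num_primes : num_primes #|G| + 1 <= eta G.
Proof.
by rewrite addn1; apply: uniq_leq_size (uniq_one_primes _) primes_sub_omega.
Qed.

(** Since omega(G) always contains 1 and the primes dividing |G|, counting
    turns the equality of sizes into an equality of sets. *)
Lemma eta_eq_num_primes :
  eta G = num_primes #|G| + 1 <->
  forall x : gT, x \in G -> x <> 1 -> prime #[x].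
Proof.
split=> [etaG x Gx /eqP ntx | prG].
  have [|_ eq_om] := uniq_min_size (uniq_one_primes _) primes_sub_omega.
    by rewrite -[size (omega G)]/(eta G) etaG addn1.
  have: #[x] \in 1%N :: primes #|G|.
    by apply: etrans (eq_om _) _; apply/omegaP; exists x.
  by rewrite inE order_eq1 (negPf ntx) mem_primes => /andP[].
apply/eqP; rewrite eqn_leq eta_ge_num_primes addn1 andbT.
apply: (@uniq_leq_size _ _ (1%N :: primes #|G|) (fset_uniq _)) => _ /omegaP[x Gx ->].
rewrite inE order_eq1 mem_primes cardG_gt0 order_dvdG // andbT.
by case: (eqVneq x 1) => //= /eqP ntx; rewrite andbT; apply: prG.
Qed.

End ElementOrders.

Lemma isog_Zp (gT : finGroupType) (G : {group gT}) n :
  0 < n -> (G \isog Zp n) = cyclic G && (#|G| == n).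
Proof.
move=> n_gt0; have cycZ: cyclic (Zp n).
  by rewrite /Zp; case: ifP => _; rewrite ?cyclic1 // Zp_cycle cycle_cyclic.
by rewrite isog_sym isog_cyclic_card ?card_Zp.
Qed.

(** * The condition gcd(n, phi(n)) = 1 *)

(** In the product formula over the prime divisors, each factor
    (p - 1) p ^ (e - 1) of phi(d) divides the factor of phi(n) at the same
    prime. *)
Lemma totient_dvd d n : 0 < n -> d %| n -> totient d %| totient n.
Proof.
move=> n_gt0 d_n; have d_gt0 := dvdn_gt0 n_gt0 d_n.
rewrite !totientE // [X in _ %| X](bigID (mem (primes d))) /=.
rewrite dvdn_mulr // -[X in _ %| X]big_filter.
have eq_pr: perm_eq (filter (mem (primes d)) (primes n)) (primes d).
  apply: uniq_perm; rewrite ?filter_uniq ?primes_uniq // => p.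
  rewrite mem_filter /= !mem_primes n_gt0 d_gt0 /=.
  case: (prime p) => //=; case p_d: (p %| d) => //=.
  exact: dvdn_trans p_d d_n.
rewrite [X in _ %| X](perm_big _ eq_pr) /=.
apply: (big_ind2 (fun a b => a %| b)) => // [a b a' b' | p _].
  exact: dvdn_mul.
rewrite dvdn_mul // dvdn_exp2l // -!subn1 leq_sub2r //.
exact: dvdn_leq_log.
Qed.

(** This heredity lets inductions on the group order reach subgroups and
    quotients. *)
Lemma coprime_totient_dvd d n :
  0 < n -> d %| n -> coprime n (totient n) -> coprime d (totient d).
Proof.
move=> n_gt0 d_n co_n; apply: (coprime_dvdl d_n).
exact: coprime_dvdr (totient_dvd n_gt0 d_n) co_n.
Qed.

(** If p ^ 2 divided |G| then p would divide both |G| and phi(|G|), so the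
    Sylow subgroups of G have prime order. *)
Lemma abelian_coprime_totient_cyclic (gT : finGroupType) (G : {group gT}) :
  coprime #|G| (totient #|G|) -> abelian G -> cyclic G.
Proof.
move=> coG abG; apply: nil_Zgroup_cyclic (abelian_nil abG).
apply/forall_inP=> P /SylowP[p p_pr sylP].
have [e oP] := p_natP (pHall_pgroup sylP); case: e => [|[|e]] in oP.
- by rewrite (card1_trivg oP) cyclic1.
- by rewrite prime_cyclic // oP.
have dPG := cardSg (pHall_sub sylP).
have := coprime_totient_dvd (cardG_gt0 G) dPG coG.
rewrite oP totient_pfactor //= coprimeMr.
by rewrite andbC coprime_pexpl // coprime_pexpr // prime_coprime // dvdnn.
Qed.

(** An element of N_G(M) induces on M an automorphism whose order divides both
    |G| and |Aut M| = phi(|M|), a divisor of phi(|G|). *)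
Lemma cyclic_coprime_totient_centralised (gT : finGroupType)
    (G M : {group gT}) :
    cyclic M -> M \subset G -> coprime #|G| (totient #|G|) ->
  'N_G(M) \subset 'C(M).
Proof.
move=> cycM sMG coG; apply/subsetP=> g /setIP[Gg nMg].
have co_MG: coprime #|G| #|Aut M|.
  rewrite card_Aut_cyclic //; apply: coprime_dvdr coG.
  exact: totient_dvd (cardSg sMG).
have := Aut_conj_aut M <[g]>; rewrite -ker_conj_aut.
move/cardSg => dAut.
have dG: #|conj_aut M @* <[g]>| %| #|G|.
  by apply: dvdn_trans (dvdn_morphim _ _) (order_dvdG Gg).
have: conj_aut M @* <[g]> = 1.
  apply/eqP; rewrite trivg_card1 -dvdn1 -(eqP co_MG) dvdn_gcd.
  by rewrite dG dAut.
move/eqP; rewrite -subG1 sub_morphim_pre ?cycle_subG //.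
Qed.

(** * Groups with trivial centre and cyclic proper subgroups *)

Section ProperCyclic.

Variables (gT : finGroupType) (G : {group gT}).
Hypothesis coG : coprime #|G| (totient #|G|).
Hypothesis cyclic_proper : forall H : {group gT}, H \proper G -> cyclic H.
Hypothesis Z1 : 'Z(G) = 1.

Let cent1_proper a : a \in G^# -> 'C_G[a] \proper G.
Proof.
case/setD1P=> nta Ga; rewrite properEneq subsetIl andbT.
apply: contra nta => /eqP/setIidPl; rewrite sub_cent1 => cGa.
by have: a \in 'Z(G); [rewrite inE Ga | rewrite Z1 => /set1P->].
Qed.

Let cent1_sub a b : a \in G^# -> b \in 'C_G[a] -> 'C_G[a] \subset 'C_G[b].
Proof.
move=> Ga Cb; rewrite subsetI subsetIl sub_cent1.
by apply: subsetP Cb; apply: cyclic_abelian (cyclic_proper (cent1_proper Ga)).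
Qed.

(** Both centralisers are abelian and contain a and b, so each centralises the
    element defining the other. *)
Lemma cent1_eq a b : a \in G^# -> b \in 'C_G[a]^# -> 'C_G[b] = 'C_G[a].
Proof.
move=> G1a /setD1P[ntb Cb]; have [[nta Ga] [Gb ab]] := (setD1P G1a, setIP Cb).
apply/eqP; rewrite eqEsubset !cent1_sub //; first by rewrite !inE ntb.
by rewrite inE Ga cent1C.
Qed.

Let cent1I_J a g : g \in G -> 'C_G[a ^ g] = 'C_G[a] :^ g.
Proof. by move=> Gg; rewrite conjIg conjGid // cent1J. Qed.

(** If a conjugate of C = 'C_G[a] by g shares a nontrivial element with C, then
    it equals C by [cent1_eq]; so g normalises C, hence centralises C, and in
    particular commutes with a. *)
Lemma cent1_normedTI a : a \in G^# -> normedTI 'C_G[a]^# G 'C_G[a].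
Proof.
move=> G1a; have [nta Ga] := setD1P G1a.
have C1a: a \in 'C_G[a]^# by rewrite in_setD1 nta inE Ga cent1id.
apply/normedTI_memJ_P; split; [by apply/set0Pn; exists a | exact: subsetIl |].
move=> b g Cb Gg; have [ntb Cb'] := setD1P Cb.
apply/idP/idP=> [Cbg | Cg]; last by rewrite in_setD1 conjg_eq1 ntb groupJ.
have nCg: g \in 'N_G('C_G[a]).
  by rewrite !inE Gg -{1}(cent1_eq G1a Cb) -cent1I_J // (cent1_eq G1a Cbg) /=.
have cCg: g \in 'C('C_G[a]).
  apply: subsetP nCg; apply: cyclic_coprime_totient_centralised coG.
    exact: cyclic_proper (cent1_proper G1a).
  exact: subsetIl.
rewrite inE Gg; apply/cent1P; apply: (centP cCg).
by case/setD1P: C1a.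
Qed.

(** The conjugates of C = 'C_G[a] are |G : C| in number and meet pairwise
    trivially, so they cover |G : C| (|C| - 1) = |G| - |G : C| nontrivial
    elements. *)
Lemma card_cent1_support a : a \in G^# ->
  #|class_support 'C_G[a]^# G| + #|G : 'C_G[a]| = #|G|.
Proof.
move=> G1a; rewrite (card_support_normedTI (cent1_normedTI G1a)).
have := Lagrange (subsetIl G 'C[a]); have := cardsD1 1 'C_G[a].
by rewrite group1 => -> <-; rewrite mulnDl mul1n addnC.
Qed.

(** A common element would, up to conjugation, be some v in 'C_G[b]^# that lies
    in a conjugate of 'C_G[a].  Then 'C_G[b] = 'C_G[v] is that conjugate, which
    therefore contains b. *)
Lemma disjoint_cent1_support a b :
    a \in G^# -> b \in G^# -> b \notin class_support 'C_G[a]^# G ->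
  class_support 'C_G[a]^# G :&: class_support 'C_G[b]^# G = set0.
Proof.
move=> G1a G1b; apply: contraNeq => /set0Pn[z /setIP[]].
case/imset2P=> u g Cu Gg Dz /imset2P[v h Cv Gh]; rewrite {z}Dz.
move/(canLR (conjgK h)); rewrite -conjgM; set k := (g * _)%g => Dv.
have Gk: k \in G by rewrite groupM ?groupV.
have [ntb Gb] := setD1P G1b.
have: b \in 'C_G[b] by rewrite inE Gb cent1id.
rewrite -(cent1_eq G1b Cv) -Dv cent1I_J // (cent1_eq G1a Cu).
case/imsetP=> w Cw Db; rewrite Db memJ_class_support //.
by rewrite in_setD1 Cw -(conjg_eq1 w k) -Db ntb.
Qed.

(** Two disjoint families of conjugates, each covering at least half of |G|
    nontrivial elements, cannot fit in G^#. *)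
Lemma centreless_trivial : G :=: 1.
Proof.
apply/eqP/idPn => /trivgPn[a Ga nta].
have G1a: a \in G^# by rewrite !inE nta.
have half b : b \in G^# -> #|G| <= #|class_support 'C_G[b]^# G|.*2.
  move=> G1b; have tiC := cent1_normedTI G1b.
  rewrite -(card_cent1_support G1b) -addnn leq_add2l.
  by rewrite (card_support_normedTI tiC) leq_pmull // card_gt0; case/andP: tiC.
have sub b : class_support 'C_G[b]^# G \subset G^#.
  rewrite subsetD1 class_support_subG; last first.
    exact: subset_trans (subsetDl _ _) (subsetIl _ _).
  apply/imset2P=> -[u g /setD1P[/eqP ntu _] _ /esym/eqP].
  by rewrite conjg_eq1 => /eqP.
have cardG1: #|G| = #|G^#|.+1 by rewrite (cardsD1 1) group1.
(* The family of a misses |G : 'C_G[a]| > 1 elements of G, so it misses an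
   element other than the identity. *)
have [b G1b b_a]: exists2 b, b \in G^# & b \notin class_support 'C_G[a]^# G.
  apply/subsetPn; apply/negP => /subset_leq_card.
  have := card_cent1_support G1a; have := proper_subn (cent1_proper G1a).
  rewrite -indexg_gt1 cardG1 => gt1 eq_card le_card.
  by have := leq_add le_card gt1; rewrite eq_card addn2 ltnn.
have := leq_add (half a G1a) (half b G1b).
rewrite addnn -doubleD leq_double -cardsUI disjoint_cent1_support //.
rewrite cards0 addn0 cardG1 leqNgt ltnS subset_leq_card //.
by rewrite subUset !sub.
Qed.

End ProperCyclic.

(** * Orders n with a unique group, and elementary abelian groups *)

(** Induction on the order, with the centre distinguishing the two cases: a
    nontrivial centre leaves a smaller quotient, which is cyclic, and the
    trivial centre is excluded by counting unless G = 1. *)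
Theorem coprime_totient_cyclic (gT : finGroupType) (G : {group gT}) :
  coprime #|G| (totient #|G|) -> cyclic G.
Proof.
have [m] := ubnP #|G|; elim: m => // m IHm in gT G *; rewrite ltnS => leGm coG.
have [Z1 | ntZ] := eqVneq 'Z(G) 1.
  rewrite (centreless_trivial coG _ Z1) ?cyclic1 // => H prHG.
  apply: IHm; first exact: leq_trans (proper_card prHG) leGm.
  exact: coprime_totient_dvd (cardSg (proper_sub prHG)) coG.
apply: abelian_coprime_totient_cyclic => //.
apply: cyclic_center_factor_abelian; apply: IHm.
  by apply: leq_trans leGm; rewrite ltn_quotient ?center_sub.
exact: coprime_totient_dvd (dvdn_quotient _ _) coG.
Qed.

Lemma elementary_abelian_group p k :
    prime p -> 0 < k ->
  exists gT : finGroupType, p.-abelem [set: gT] /\ #|[set: gT]| = (p ^ k)%N.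
Proof.
move=> p_pr k_gt0; exists 'rV['F_p]_k; split.
  exact: fin_Fp_lmod_abelem.
by rewrite cardsT card_mx card_Fp // mul1n.
Qed.

(** * Extremal values of eta *)

Local Close Scope group_scope.

Theorem theorem8p1 (n : nat) (n_ge2 : 2 <= n) :
  (max_eta n = tau n /\
   forall (gT : finGroupType) (G : {group gT}), #|G| = n ->
     (eta G = max_eta n <-> G \isog Zp n)) /\
  num_primes n + 1 <= min_eta n /\
  (forall p k : nat, prime p -> n = p ^ k -> min_eta n = 2) /\
  (min_eta n = num_primes n + 1 <->
   exists (gT : finGroupType) (G : {group gT}), #|G| = n /\
     forall x : gT, x \in G -> x <> 1%g -> prime #[x]%g) /\
  (gcdn n (totient n) = 1 ->
   (forall (gT : finGroupType) (G : {group gT}), #|G| = n <-> G \isog Zp n) /\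
   min_eta n = max_eta n /\ max_eta n = tau n).
Proof.
have n_gt0: 0 < n := ltnW n_ge2.
have [[gM [GM [oGM etaM]]] le_max] := max_etaP n_gt0.
have [[gm [Gm [oGm etam]]] ge_min] := min_etaP n_gt0.
have eta_value_of gT (G : {group gT}) : #|G| = n -> eta_value n (eta G).
  by exists gT, G.
have maxE: max_eta n = tau n.
  apply/eqP; rewrite eqn_leq -{1}etaM -{1}oGM eta_le_tau /=.
  have oZ: #|Zp_group n| = n by apply: card_Zp.
  have /andP[cycZ _]: cyclic (Zp n) && (#|Zp n| == n).
    by rewrite -(isog_Zp (Zp_group n)) ?isog_refl.
  move: cycZ; rewrite (cyclic_eta (Zp_group n)) oZ => /eqP <-.
  exact/le_max/eta_value_of.
have min_ge: num_primes n + 1 <= min_eta n.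
  by rewrite -etam -oGm eta_ge_num_primes.
have minE: min_eta n = num_primes n + 1 <->
   exists (gT : finGroupType) (G : {group gT}), #|G| = n /\
     forall x : gT, x \in G -> x <> 1%g -> prime #[x]%g.
  split=> [min_eq | [gT [G [oG prG]]]].
    by exists gm, Gm; split=> //; apply/eta_eq_num_primes; rewrite etam oGm.
  apply/eqP; rewrite eqn_leq min_ge andbT -{2}oG.
  by move/eta_eq_num_primes: prG => <-; apply/ge_min/eta_value_of.
split; [|split; [|split; [|split]]] => //.
- split=> // gT G oG; rewrite maxE isog_Zp // oG eqxx andbT cyclic_eta oG.
  by split=> /eqP.
- move=> p k p_pr Dn; have k_gt0: 0 < k by case: k Dn n_ge2 => // ->.
  have ->: 2 = num_primes n + 1.
    by rewrite Dn /num_primes primesX // primes_prime.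
  apply/minE; have [gT [abelG oG]] := elementary_abelian_group p_pr k_gt0.
  exists gT, [set: gT]%G; rewrite Dn; split=> // x Gx /eqP ntx.
  by rewrite (abelem_order_p abelG).
move/eqP=> co_n.
have cyc gT (G : {group gT}) : #|G| = n -> cyclic G.
  by move=> oG; apply: coprime_totient_cyclic; rewrite oG.
split=> [gT G | ].
  by rewrite isog_Zp //; split=> [oG | /andP[_ /eqP]//]; rewrite cyc oG /=.
split=> //; rewrite maxE -etam -oGm.
by apply/eqP; rewrite -cyclic_eta cyc.
Qed.
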